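(* Let $k$ be any positive integer and let $\mathbf{x}=(x_1,\ldots,x_n)^\top\in\mathbb{R}^n$ be a random vector with characteristic function $\phi_{\mathbf{x}}(\mathbf{t})=E[\exp(\imath\,\mathbf{t}^\top\mathbf{x})]$, $\mathbf{t}\in\mathbb{R}^n$. Then $$E[\mathbf{x}^k]=\frac{1}{\imath^k}\,\frac{d^k}{d\mathbf{t}^k}\phi_{\mathbf{x}}(\mathbf{t})\Big|_{\mathbf{t}=0},$$ where $0$ is the zero vector in $\mathbb{R}^n$.
   Context: Here $\imath$ is the imaginary unit. A random vector is a vector each of whose components is a random variable. $\mathbf{x}^k$ denotes the $k$-fold outer product $\mathbf{x}\times\mathbf{x}\times\cdots\times\mathbf{x}$, the $k$-order $n$-dimensional tensor with entries $(\mathbf{x}^k)_{j_1\ldots j_k}=x_{j_1}x_{j_2}\cdots x_{j_k}$, $j_1,\ldots,j_k\in\{1,\ldots,n\}$, and the expectation of a random tensor is taken entrywise; $E[\mathbf{x}^k]$ is called the $k$-moment of $\mathbf{x}$. For a scalar function $\phi$ of $\mathbf{t}=(t_1,\ldots,t_n)^\top\in\mathbb{R}^n$, $\frac{d^k}{d\mathbf{t}^k}\phi$ denotes the $k$-order $n$-dimensional tensor with entries $\frac{\partial^k\phi}{\partial t_{j_1}\partial t_{j_2}\cdots\partial t_{j_k}}$.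
   Formalization: The k-moment E[x^k] is assumed to exist, i.e. every entry x_{j1}...x_{jk} is integrable; without this the identity fails or is meaningless (e.g. a Cauchy variable with k = 1). Existence of the derivatives at 0 is then proved. *)

(* Defs.v *)
From HB Require Import structures.
From mathcomp Require Export all_boot all_order all_algebra.
From mathcomp Require Export complex.
From mathcomp Require Export all_classical all_reals all_analysis.

Set Implicit Arguments.
Unset Strict Implicit.
Unset Printing Implicit Defensive.

Import Order.TTheory GRing.Theory Num.Theory.
Import numFieldNormedType.Exports.

Local Open Scope classical_set_scope.
Local Open Scope ring_scope.

(* [Rcomplex R] is the library's alias of [R[i]] carrying the structure of a
   vector space over [R], normed by the modulus.  The instances below add the
   topology of the modulus, so that ['D_v f] makes sense for a complex-valued
   function [f] of real variables. *)
Section Rcomplex_normedModType.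
Variable R : realType.

Lemma Rcomplex_normZ (l : R) (z : Rcomplex R) : `|l *: z| = `|l| * `|z|.
Proof.
case: z => a b; rewrite /Num.norm /= !exprMn -mulrDr sqrtrM ?sqr_ge0//.
by rewrite sqrtr_sqr.
Qed.

HB.instance Definition _ := isPointed.Build (Rcomplex R) 0.
HB.instance Definition _ :=
  PseudoMetric.copy (Rcomplex R) (pseudoMetric_normed (Rcomplex R)).
HB.instance Definition _ :=
  NormedZmod_PseudoMetric_eq.Build R (Rcomplex R) erefl.
HB.instance Definition _ :=
  PseudoMetricNormedZmod_Lmodule_isNormedModule.Build R (Rcomplex R)
    Rcomplex_normZ.

End Rcomplex_normedModType.

Definition cexp (R : realType) (z : R[i]) : R[i] :=
  (expR (complex.Re z))%:C%C * (cos (complex.Im z) +i* sin (complex.Im z))%C.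

Section partial_derivatives.
Context (R : realType) (n : nat) (W : normedModType R).
Implicit Types (s : seq 'I_n) (f : 'cV[R]_n -> W) (t : 'cV[R]_n).

Definition partial (j : 'I_n) f : 'cV[R]_n -> W := 'D_(delta_mx j 0) f.

(* For [s = [:: j_1; ..; j_k]] this is
   [d/dt_{j_1} (d/dt_{j_2} ( .. (d/dt_{j_k} f)))]. *)
Definition iter_partial s f : 'cV[R]_n -> W := foldr partial f s.

(* The library's ['D_v f t] is total, with a default value when the limit of
   the difference quotients does not exist; this predicate says that all the
   limits involved in [iter_partial s f t] exist, those of lower order being
   required in a neighbourhood of [t]. *)
Fixpoint ex_iter_partial s f t : Prop :=
  if s is j :: s' then
    (\forall u \near t, ex_iter_partial s' f u) /\
    derivable (iter_partial s' f) t (delta_mx j 0)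
  else True.

(* The tensor of order [k] and dimension [n] of the [k]-th derivatives of [f];
   tensors are functions of the multi-index [J = (j_1, .., j_k)]. *)
Definition derive_tensor (k : nat) f t (J : k.-tuple 'I_n) : W :=
  iter_partial J f t.

End partial_derivatives.

Definition outer_power (R : realType) (n k : nat) (x : 'cV[R]_n)
    (J : k.-tuple 'I_n) : R :=
  \prod_(l < k) x (tnth J l) 0.

Section random_vectors.
Context d (T : measurableType d) (R : realType) (P : probability T R).

Definition complex_expectation (Z : T -> R[i]) : R[i] :=
  (fine 'E_P[fun w => complex.Re (Z w)] +i*
   fine 'E_P[fun w => complex.Im (Z w)])%C.

Context (n : nat) (X : 'I_n -> {RV P >-> R}).

Definition rvec (w : T) : 'cV[R]_n := \col_i X i w.

Definition char_fun (t : 'cV[R]_n) : Rcomplex R :=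
  complex_expectation (fun w => cexp ('i%C * ((t^T *m rvec w) 0 0)%:C%C)).

Definition has_moment (k : nat) : Prop :=
  forall J : k.-tuple 'I_n,
    P.-integrable setT (EFin \o (fun w => outer_power (rvec w) J)).

(* [fine] only drops the infinite values, which do not occur under
   [has_moment k]. *)
Definition moment (k : nat) (J : k.-tuple 'I_n) : R :=
  fine 'E_P[fun w => outer_power (rvec w) J].

End random_vectors.

(* Main.v *)
(* Write p_s for the product of the coordinates x_j, j in s.  A derivative of
   cos is a shift of its phase by pi / 2, so differentiating
   E[p_s cos (t^T x + c)] in t_j under the integral gives
   E[p_(j :: s) cos (t^T x + (c + pi / 2))], dominated by E|p_(j :: s)|, which
   is finite as soon as the k-th moments are and s has length < k.  Since sin is
   cos shifted by - pi / 2, the real and the imaginary part of every iterated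
   derivative of the characteristic function have this form; the phase
   accumulated after k steps is the factor i^k. *)
Require Import Defs.
From mathcomp Require Import measurable_realfun ring.

Set Implicit Arguments.
Unset Strict Implicit.
Unset Printing Implicit Defensive.

Import Order.TTheory GRing.Theory Num.Theory.
Import numFieldNormedType.Exports.

Local Open Scope classical_set_scope.
Local Open Scope ring_scope.

Lemma is_derive_phase (R : realType) (p x th h : R) :
  is_derive h 1 (fun h => p * cos (h * x + th))
    (x * p * cos (h * x + (th + pi / 2))).
Proof.
have dphase : is_derive h 1 (fun h : R => h * x + th) x.
  by apply: is_derive_eq; rewrite addr0 /GRing.scale/= mulr0 mulr1 add0r.
have dcos : is_derive h 1 (fun h : R => cos (h * x + th))
    (- sin (h * x + th) * x).
  exact: (@is_derive1_comp R cos (fun h : R => h * x + th)).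
apply: is_derive_eq.
by rewrite addrA cosDpihalf /GRing.scale/=; ring.
Qed.

Lemma integrable_phase (d : measure_display) (T : measurableType d)
    (R : realType) (mu : {measure set T -> \bar R}) (p y : T -> R) :
  mu.-integrable setT (EFin \o p) -> measurable_fun setT y ->
  mu.-integrable setT (EFin \o (fun w => p w * cos (y w))).
Proof.
move=> ip my; have /integrableP[/measurable_EFinP mp _] := ip.
have mcos : measurable_fun setT (@cos R).
  by apply: continuous_measurable_fun; exact: continuous_cos.
apply: (le_integrable measurableT _ _ ip) => [|w _].
  by apply/measurable_EFinP/measurable_funM => //; exact: measurableT_comp.
rewrite /= lee_fin normrM ler_piMr//.
by rewrite ler_norml cos_geN1 cos_le1.
Qed.

Lemma cvg_phase_integral (d : measure_display) (T : measurableType d)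
    (R : realType) (mu : {measure set T -> \bar R}) (p x th : T -> R) :
  measurable_fun setT x -> measurable_fun setT th ->
  mu.-integrable setT (EFin \o p) ->
  mu.-integrable setT (EFin \o (fun w => x w * p w)) ->
  let F (h : R) := \int[mu]_w (p w * cos (h * x w + th w)) in
  h^-1 *: (F h - F 0) @[h --> 0^'] -->
    \int[mu]_w (x w * p w * cos (th w + pi / 2)).
Proof.
move=> mx mth ip ixp F.
pose f (h : R) w := p w * cos (h * x w + th w).
have df1 h w : partial1of2 f h w = x w * p w * cos (h * x w + (th w + pi / 2)).
  by rewrite partial1of2E; have [] := is_derive_phase (p w) (x w) (th w) h.
have <- : \int[mu]_w partial1of2 f 0 w =
    \int[mu]_w (x w * p w * cos (th w + pi / 2)).
  by apply: eq_Rintegral => w _; rewrite df1 mul0r add0r.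
suff : h^-1 *: (F (h + 0) - F 0) @[h --> 0^'] --> \int[mu]_w partial1of2 f 0 w.
  by under eq_fun do rewrite addr0.
(* The parameter [h] ranges over the open interval from -1 to 1. Since cosines are bounded by 1,
   [|x w * p w|] dominates the derivative uniformly in [h], so any interval around 0 would serve. *)
apply: (@cvg_differentiation_under_integral R _ T mu f setT measurableT
  0 (-1) 1 _ _ _ (fun w => `|x w * p w|)).
- by rewrite /= in_itv/= ltrN10 ltr01.
- move=> h _; apply: integrable_phase => //.
  by apply: measurable_funD => //; exact: measurable_funM.
- by move=> h w _ _; have [] := is_derive_phase (p w) (x w) (th w) h.
- by [].
- exact: integrable_norm ixp.
- move=> h w _ _; rewrite df1 normrM ler_piMr//.
  by rewrite ler_norml cos_geN1 cos_le1.
Qed.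

Lemma is_derive_complex (R : realType) (V : normedModType R) (t v : V)
    (f g : V -> R) (a b : R) :
  is_derive t v f a -> is_derive t v g b ->
  is_derive t v (fun u => (f u +i* g u)%C : Rcomplex R) (a +i* b)%C.
Proof.
move=> [df dfa] [dg dgb].
suff qcvg : h^-1 *: (((f (h *: v + t)) +i* (g (h *: v + t)))%C -
      (f t +i* g t)%C : Rcomplex R) @[h --> 0^'] --> ((a +i* b)%C : Rcomplex R).
  by split; [apply/cvg_ex; exists (a +i* b)%C|exact/cvg_lim].
(* Decomposing the quotient over the real basis 1, i leaves two real difference quotients
   multiplying constant vectors. *)
rewrite (_ : (fun h : R => _) = (fun h : R =>
    (h^-1 *: (f (h *: v + t) - f t)) *: (1 : Rcomplex R) +
    (h^-1 *: (g (h *: v + t) - g t)) *: ('i%C : Rcomplex R))); last first.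
  apply/funext => h; apply/eqP.
  by rewrite eq_complex /= !mulr0 !mulr1 addr0 add0r !eqxx.
rewrite (_ : (a +i* b)%C = a *: (1 : Rcomplex R) + b *: ('i%C : Rcomplex R)).
  apply: cvgD; apply: cvgZr_tmp.
  - by rewrite -dfa.
  - by rewrite -dgb.
by apply/eqP; rewrite eq_complex /= !mulr0 !mulr1 addr0 add0r !eqxx.
Qed.

Section moments.
Context (d : measure_display) (T : measurableType d) (R : realType)
  (P : probability T R) (n : nat) (X : 'I_n -> {RV P >-> R}).

Definition monomial (s : seq 'I_n) (w : T) : R := \prod_(j <- s) X j w.

Lemma measurable_monomial s : measurable_fun setT (monomial s).
Proof. exact: measurable_prod. Qed.

Lemma outer_power_rvec k (J : k.-tuple 'I_n) w :
  outer_power (rvec X w) J = monomial J w.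
Proof.
by rewrite /monomial big_tuple; apply: eq_bigr => l _; rewrite mxE.
Qed.

(* The coordinate of largest modulus dominates the whole monomial. *)
Lemma normr_monomial_le k s w : (size s <= k)%N ->
  `|monomial s w| <= 1 + \sum_i `|X i w| ^+ k.
Proof.
move=> sk; have sum_ge0 : 0 <= \sum_i `|X i w| ^+ k.
  by apply: sumr_ge0 => i _; rewrite exprn_ge0.
(* A maximal coordinate needs at least one index, here [j0]; the empty product is 1. *)
case: s sk => [|j0 s0]; first by rewrite /monomial big_nil normr1 lerDl.
set s := j0 :: s0 => sk.
have [i _ maxi] := Order.TotalTheory.arg_maxP
  (fun i => `|X i w|) (isT : xpredT j0).
have ms : `|monomial s w| <= `|X i w| ^+ size s.
  rewrite /monomial normr_prod; elim: (s) => [|j s' IH].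
    by rewrite big_nil expr0.
  rewrite big_cons exprS; apply: ler_pM => //; last exact: maxi.
  exact: prodr_ge0.
have ge_i : `|X i w| ^+ k <= \sum_i `|X i w| ^+ k.
  rewrite (bigD1 i)//= lerDl; apply: sumr_ge0 => l _; exact: exprn_ge0.
(* If the maximum is at most 1, the summand 1 is the bound; otherwise raising the exponent from
   [size s] to [k] only enlarges the power. *)
apply: le_trans ms _; have [Xi1|/ltW Xi1] := leP `|X i w| 1.
  by rewrite ler_wpDr ?exprn_ile1.
by rewrite ler_wpDl// (le_trans _ ge_i)// ler_weXn2l.
Qed.

(** The hypothesis concerns products of exactly [k] factors. Shorter ones follow from the bound
    above, whose constant 1 is integrable because [P] is finite. *)
Lemma integrable_monomial k s : has_moment X k -> (size s <= k)%N ->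
  P.-integrable setT (EFin \o monomial s).
Proof.
move=> mom sk; pose G w := 1 + \sum_i `|X i w| ^+ k.
have iX i : P.-integrable setT (EFin \o (fun w => `|X i w| ^+ k)).
  (* The multi-index (i, .., i) yields the k-th power of the single coordinate [X i]. *)
  have := integrable_norm (mom [tuple of nseq k i]); apply: eq_integrable => //.
  move=> w _ /=; rewrite outer_power_rvec /monomial normr_prod.
  by rewrite big_nseq iter_mulr_1.
have iG : P.-integrable setT (EFin \o G).
  rewrite (_ : EFin \o G =
      (cst 1%E \+ (fun w => \sum_i (`|X i w| ^+ k)%:E))%E); last first.
    by apply/funext => w; rewrite /= EFinD sumEFin.
  apply: integrableD => //; first exact: finite_measure_integrable_cst.
  by apply: integrable_sum => // i _; exact: iX.
apply: (le_integrable measurableT _ _ iG) => [|w _].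
  exact/measurable_EFinP/measurable_monomial.
by rewrite /= lee_fin (le_trans (normr_monomial_le w sk))// ler_norm.
Qed.

Definition phase_moment (s : seq 'I_n) (c : R) (t : 'cV[R]_n) : R :=
  \int[P]_w (monomial s w * cos ((t^T *m rvec X w) 0 0 + c)).

Lemma dot_rvec (t : 'cV[R]_n) w :
  (t^T *m rvec X w) 0 0 = \sum_i t i 0 * X i w.
Proof. by rewrite mxE; apply: eq_bigr => i _; rewrite !mxE. Qed.

Lemma dot_rvec_shift (j : 'I_n) (h : R) (t : 'cV[R]_n) w :
  ((h *: delta_mx j 0 + t)^T *m rvec X w) 0 0 =
  h * X j w + (t^T *m rvec X w) 0 0.
Proof.
by rewrite linearD linearZ /= trmx_delta mulmxDl -scalemxAl -rowE !mxE.
Qed.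

(** Moving [t] by [h] along the j-th axis adds [h * X j w] to the inner product, so this is
    [cvg_phase_integral] with [x := X j] and with t^T x + c as the phase at h = 0. *)
Lemma is_derive_phase_moment k j s c t : has_moment X k -> (size s < k)%N ->
  is_derive t (delta_mx j 0) (phase_moment s c)
    (phase_moment (j :: s) (c + pi / 2) t).
Proof.
move=> mom sk.
have mth : measurable_fun setT (fun w => (t^T *m rvec X w) 0 0 + c).
  under eq_fun do rewrite dot_rvec.
  apply: measurable_funD => //; apply: measurable_sum => i.
  exact: measurable_funM.
have ixp : P.-integrable setT (EFin \o (fun w => X j w * monomial s w)).
  have := integrable_monomial mom (sk : (size (j :: s) <= k)%N).
  by apply: eq_integrable => // w _; rewrite /= /monomial big_cons.
have qcvg := cvg_phase_integral (measurable_funPT (X j)) mth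
  (integrable_monomial mom (ltnW sk)) ixp.
have {}qcvg : h^-1 *: (phase_moment s c (h *: delta_mx j 0 + t) -
    phase_moment s c t) @[h --> 0^'] --> phase_moment (j :: s) (c + pi / 2) t.
  move: qcvg; rewrite /phase_moment /=.
  under eq_fun => h.
    under eq_Rintegral do rewrite addrA -dot_rvec_shift.
    under [X in _ - X]eq_Rintegral do rewrite mul0r add0r.
    over.
  under [X in _ --> X -> _]eq_Rintegral do rewrite -addrA.
  under [X in _ -> _ --> X]eq_Rintegral do rewrite /monomial big_cons.
  exact.
by split; [apply/cvg_ex; exists (phase_moment (j :: s) (c + pi / 2) t)
  |exact/cvg_lim].
Qed.

(** With m the length of [s], this is E[i^m p_s exp(i t^T x)]: the factor i^m is the phase m pi / 2,
    and the further - pi / 2 turns cosine into sine. *)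
Definition complex_phase_moment (s : seq 'I_n) (t : 'cV[R]_n) : Rcomplex R :=
  (phase_moment s ((pi / 2) *+ size s) t +i*
   phase_moment s ((pi / 2) *+ size s - pi / 2) t)%C.

Lemma char_funE : char_fun X = complex_phase_moment [::].
Proof.
apply/funext => t; rewrite /char_fun /complex_expectation unlock.
rewrite /complex_phase_moment /phase_moment /Rintegral /=.
congr (fine _ +i* fine _)%C; apply: eq_integral => w _; congr EFin;
  rewrite /monomial big_nil !mul1r !mul0r subrr expR0 mul1r.
- by rewrite subr0 add0r addr0.
- by rewrite addr0 !add0r cosBpihalf.
Qed.

(** Existence and value go through one induction: derivability of the next iterate is read off the
    closed form of the previous one. It holds at every [t], which settles the neighbourhood
    condition. *)
Lemma iter_partial_char_fun k s : has_moment X k -> (size s <= k)%N ->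
  (forall t, ex_iter_partial s (char_fun X) t) /\
  iter_partial s (char_fun X) = complex_phase_moment s.
Proof.
move=> mom; elim: s => [|j s IH] sk; first by split; last exact: char_funE.
have [ex_s iter_s] := IH (ltnW sk).
have dC t : is_derive t (delta_mx j 0) (complex_phase_moment s)
    (complex_phase_moment (j :: s) t).
  rewrite /complex_phase_moment [(pi / 2) *+ size (j :: s)]mulrSr.
  rewrite [in X in (_ +i* X)%C]addrAC.
  by apply: is_derive_complex; exact: is_derive_phase_moment mom sk.
split=> [t|]; last first.
  by apply/funext => t; rewrite /= iter_s; exact: derive_val.
split; first exact: (filterE (nbhs_filter t)) ex_s.
by rewrite iter_s; have [] := dC t.
Qed.

(** At t = 0 the cosine no longer depends on the sample point and leaves the integral; the two
    cosines that remain are the real and imaginary parts of i^k. *)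
Lemma complex_phase_moment0 k (J : k.-tuple 'I_n) : has_moment X k ->
  complex_phase_moment J 0 = ('i%C ^+ k) * (moment X J)%:C%C.
Proof.
move=> mom.
have phase0 c : phase_moment J c 0 = moment X J * cos c.
  have -> : moment X J = \int[P]_w monomial J w.
    rewrite /moment unlock; congr fine; apply: eq_integral => w _.
    by rewrite outer_power_rvec.
  rewrite /phase_moment -RintegralZr//; last first.
    by apply: integrable_monomial mom _; rewrite size_tuple.
  by apply: eq_Rintegral => w _; rewrite trmx0 mul0mx mxE add0r.
have i_pow m : 'i%C ^+ m =
    (cos ((pi / 2) *+ m) +i* sin ((pi / 2) *+ m))%C :> R[i].
  elim: m => [|m IH]; first by rewrite cos0 sin0.
  rewrite exprSr IH [(pi / 2) *+ m.+1]mulrSr cosDpihalf sinDpihalf.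
  apply/eqP; rewrite eq_complex /=.
  by rewrite !(mulr0, mulr1, add0r, addr0, sub0r) !eqxx.
rewrite /complex_phase_moment !phase0 cosBpihalf i_pow size_tuple.
apply/eqP; rewrite eq_complex /= !mulr0 subr0 add0r.
by rewrite ![moment X J * _]mulrC !eqxx.
Qed.

End moments.

Theorem lemma1p1 (d : measure_display) (T : measurableType d) (R : realType)
    (P : probability T R) (n k : nat) (X : 'I_n -> {RV P >-> R}) :
  (0 < k)%N ->
  has_moment X k ->
  forall J : k.-tuple 'I_n,
    ex_iter_partial J (char_fun X) 0 /\
    (moment X J)%:C%C = ('i%C ^+ k)^-1 * derive_tensor (char_fun X) 0 J.
Proof.
move=> _ mom J.
have sizeJ : (size J <= k)%N by rewrite size_tuple.
have [exJ iterJ] := iter_partial_char_fun mom sizeJ.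
split; first exact: exJ.
rewrite /derive_tensor iterJ complex_phase_moment0// mulKf//.
by rewrite expf_neq0// eq_complex /= oner_eq0 andbF.
Qed.
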